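(* If $E\neq0$ and $\gamma_A\neq1$, the eigenvalues of $\mathcal{P}^{-1}\mathcal{A}$ belong to $$\left[\mu_a(\gamma_{\min}^A,\gamma_{\max}^R,\gamma_{\max}^K),\ \lambda_-(\gamma_{\max}^A,\gamma_{\min}^R)\right]\cup I_+^{\pi_E},$$ where $I_+^{\pi_E}=[\mu_l^+,\mu_u^+]$ and $$\mu_l^+=\min\{\gamma_{\min}^X,\ \mu_b^E(\gamma_{\min}^A,\gamma_{\max}^R,\gamma_{\min}^X,0)\},$$ $$\mu_u^+=\max\left\{\mu_c^E(\gamma_{\max}^A,\gamma_{\min}^R,\gamma_{\max}^K,\gamma_{\max}^E),\ \mu_c^E(\gamma_{\max}^A,\gamma_{\max}^R,\gamma_{\max}^K,\gamma_{\max}^E),\ \beta_c^E(\gamma_{\max}^E,\gamma_{\max}^K)\right\},$$ with $$\beta_c^E(\gamma_E,\gamma_K)=\gamma_K+\frac{\gamma_E}{2}+\sqrt{\left(\gamma_K+\frac{\gamma_E}{2}\right)^2+\gamma_K}.$$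
   Context: Let $n\ge m\ge p$ be positive integers, $A\in\mathbb{R}^{n\times n}$ symmetric positive definite (SPD), $B\in\mathbb{R}^{m\times n}$ and $C\in\mathbb{R}^{p\times m}$ of full row rank, $E\in\mathbb{R}^{p\times p}$ symmetric positive semidefinite, and $$\mathcal{A}=\begin{bmatrix}A&B^\top&0\\ B&0&C^\top\\ 0&C&E\end{bmatrix}.$$ Let $\widehat A$ be an SPD approximation of $A$; let $\widetilde S=B\widehat A^{-1}B^\top$ and let $\widehat S$ be an SPD approximation of $\widetilde S$; let $\widetilde X=E+C\widehat S^{-1}C^\top$ and let $\widehat X$ be an SPD approximation of $\widetilde X$. The preconditioner is $\mathcal{P}=\mathcal{P}_L\mathcal{P}_D^{-1}\mathcal{P}_L^\top$ with $$\mathcal{P}_L=\begin{bmatrix}\widehat A&0&0\\ B&-\widehat S&0\\ 0&C&\widehat X\end{bmatrix},\qquad \mathcal{P}_D=\begin{bmatrix}\widehat A&0&0\\ 0&\widehat S&0\\ 0&0&\widehat X\end{bmatrix}.$$ Put $K=\widehat X^{-1/2}C\widehat S^{-1/2}$. Define the intervals $I_\ast=[\gamma_{\min}^\ast,\gamma_{\max}^\ast]$ for $\ast\in\{A,R,X,E,K\}$, whose endpoints are the smallest and largest eigenvalues of, respectively, $\widehat A^{-1}A$, $\widehat S^{-1}\widetilde S$, $\widehat X^{-1}\widetilde X$, $\widehat X^{-1}E$, $KK^\top$. The indicators $\gamma_A\in I_A$, $\gamma_R\in I_R$, $\gamma_X\in I_X$, $\gamma_E\in I_E$, $\gamma_K\in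 I_K$ denote Rayleigh quotients of, respectively, $\widehat A^{-1/2}A\widehat A^{-1/2}$, $\widehat S^{-1/2}\widetilde S\widehat S^{-1/2}$, $\widehat X^{-1/2}\widetilde X\widehat X^{-1/2}$, $\widehat X^{-1/2}E\widehat X^{-1/2}$, $KK^\top$ at nonzero vectors, the vector arguments being suppressed in the notation; the last three are taken at a common vector and satisfy $\gamma_X=\gamma_K+\gamma_E$. The condition $\gamma_A\neq1$ refers to this indicator, as it appears in the coefficients of the polynomials below. Standing assumptions: $\gamma_{\min}^A<1<\gamma_{\max}^A<2$, $1\in I_R$, $1\in I_X$. Define $p(\lambda;\gamma_A,\gamma_R)=\lambda^2-\lambda(\gamma_A\gamma_R+\gamma_A-2\gamma_R)-\gamma_R$, with roots $\lambda_\pm(\gamma_A,\gamma_R)=\eta\pm\sqrt{\eta^2+\gamma_R}$, where $\eta=\tfrac12(\gamma_R+1)\gamma_A-\gamma_R$; $$\pi(\lambda;\gamma_A,\gamma_R,\gamma_K)=(1+\lambda)^2(\gamma_A-\lambda)\gamma_K+p(\lambda;\gamma_A,\gamma_R)\,\lambda\,(1+\gamma_K);$$ $$\pi_E(\lambda;\gamma_A,\gamma_R,\gamma_K,\gamma_E)=\pi(\lambda;\gamma_A,\gamma_R,\gamma_K)-\gamma_E\,p(\lambda;\gamma_A,\gamma_R).$$ For $\gamma_A\neq1$, the three real roots of $\pi$ are denoted $\mu_a<0<\mu_b<\mu_c$ (functions of $(\gamma_A,\gamma_R,\gamma_K)$), and those of $\pi_E$ are denoted $\mu_a^E<0<\mu_b^E<\mu_c^E$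 (functions of $(\gamma_A,\gamma_R,\gamma_K,\gamma_E)$, in this order of arguments). *)

(* Defs.v *)
From HB Require Import structures.
From mathcomp Require Import all_boot all_order all_algebra.
From mathcomp Require Import reals polyrcf complex.

Set Implicit Arguments.
Unset Strict Implicit.
Unset Printing Implicit Defensive.

Import Order.TTheory GRing.Theory Num.Theory.

Local Open Scope ring_scope.

Section Matrices.
Variable R : realType.

Definition rayleigh n (M : 'M[R]_n) (v : 'cV[R]_n) : R :=
  (v^T *m M *m v) 0 0 / (v^T *m v) 0 0.

Definition spd_mx n (M : 'M[R]_n) : Prop :=
  M^T = M /\ forall v : 'cV[R]_n, v != 0 -> 0 < (v^T *m M *m v) 0 0.

Definition spsd_mx n (M : 'M[R]_n) : Prop :=
  M^T = M /\ forall v : 'cV[R]_n, 0 <= (v^T *m M *m v) 0 0.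

(* For SPD M, this determines Q uniquely: Q = M^(-1/2). *)
Definition is_invsqrt n (M Q : 'M[R]_n) : Prop :=
  spd_mx Q /\ Q *m Q = invmx M.

(* rootsR lists the distinct real roots of a nonzero polynomial in increasing
   order, so these are the smallest and the largest real eigenvalue. *)
Definition eig_min n (M : 'M[R]_n) : R := head 0 (rootsR (char_poly M)).
Definition eig_max n (M : 'M[R]_n) : R := last 0 (rootsR (char_poly M)).

End Matrices.

Section Preconditioner.
Variables (R : realType) (n m p : nat).

Definition block3_mx (M11 : 'M[R]_n) (M12 : 'M[R]_(n, m)) (M13 : 'M[R]_(n, p))
    (M21 : 'M[R]_(m, n)) (M22 : 'M[R]_m) (M23 : 'M[R]_(m, p))
    (M31 : 'M[R]_(p, n)) (M32 : 'M[R]_(p, m)) (M33 : 'M[R]_p) :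
    'M[R]_(n + m + p) :=
  block_mx (block_mx M11 M12 M21 M22) (col_mx M13 M23) (row_mx M31 M32) M33.

Definition saddle_mx (A : 'M[R]_n) (B : 'M[R]_(m, n)) (C : 'M[R]_(p, m))
    (E : 'M[R]_p) : 'M[R]_(n + m + p) :=
  block3_mx A B^T 0
            B 0   C^T
            0 C   E.

Definition Stilde (B : 'M[R]_(m, n)) (Ah : 'M[R]_n) : 'M[R]_m :=
  B *m invmx Ah *m B^T.

Definition Xtilde (C : 'M[R]_(p, m)) (E : 'M[R]_p) (Sh : 'M[R]_m) : 'M[R]_p :=
  E + C *m invmx Sh *m C^T.

Definition precond_L (B : 'M[R]_(m, n)) (C : 'M[R]_(p, m))
    (Ah : 'M[R]_n) (Sh : 'M[R]_m) (Xh : 'M[R]_p) : 'M[R]_(n + m + p) :=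
  block3_mx Ah 0      0
            B  (- Sh) 0
            0  C      Xh.

Definition precond_D (Ah : 'M[R]_n) (Sh : 'M[R]_m) (Xh : 'M[R]_p) :
    'M[R]_(n + m + p) :=
  block3_mx Ah 0  0
            0  Sh 0
            0  0  Xh.

Definition precond (B : 'M[R]_(m, n)) (C : 'M[R]_(p, m))
    (Ah : 'M[R]_n) (Sh : 'M[R]_m) (Xh : 'M[R]_p) : 'M[R]_(n + m + p) :=
  precond_L B C Ah Sh Xh *m invmx (precond_D Ah Sh Xh)
    *m (precond_L B C Ah Sh Xh)^T.

End Preconditioner.

Section Polynomials.
Variable R : realType.
Implicit Types gA gR gK gE : R.

Definition p_poly gA gR : {poly R} :=
  'X^2 - (gA * gR + gA - 2 * gR) *: 'X - gR%:P.

Definition lambda_minus gA gR : R :=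
  let eta := (gR + 1) * gA / 2 - gR in eta - Num.sqrt (eta ^+ 2 + gR).

Definition pi_poly gA gR gK : {poly R} :=
  gK *: ((1 + 'X) ^+ 2 * (gA%:P - 'X)) + (1 + gK) *: (p_poly gA gR * 'X).

Definition piE_poly gA gR gK gE : {poly R} :=
  pi_poly gA gR gK - gE *: p_poly gA gR.

(* When 0 < gA, gR, gK, 0 <= gE and gA != 1, both cubics have exactly three
   distinct real roots, so that positions 0, 1, 2 of the increasing list rootsR
   are the roots indexed a, b, c. *)
Definition mu_a gA gR gK : R := nth 0 (rootsR (pi_poly gA gR gK)) 0.
Definition muE_b gA gR gK gE : R := nth 0 (rootsR (piE_poly gA gR gK gE)) 1.
Definition muE_c gA gR gK gE : R := nth 0 (rootsR (piE_poly gA gR gK gE)) 2.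

Definition betaE_c gE gK : R :=
  gK + gE / 2 + Num.sqrt ((gK + gE / 2) ^+ 2 + gK).

End Polynomials.

Section Indicators.
Variables (R : realType) (n m p : nat).
(* At, Rt, Kt, Et stand for the symmetric matrices whose Rayleigh quotients are
   the indicators gamma_A, gamma_R, gamma_K, gamma_E. *)
Variables (At : 'M[R]_n) (Rt : 'M[R]_m) (Kt Et : 'M[R]_p).

(* gA occurs as the indicator gamma_A in the coefficients of a polynomial pi_E
   that has the root lam; gamma_K and gamma_E are taken at a common vector. *)
Definition gammaA_at (lam gA : R) : Prop :=
  exists (u : 'cV[R]_n) (v : 'cV[R]_m) (z : 'cV[R]_p),
    [/\ [/\ u != 0, v != 0 & z != 0],
        gA = rayleigh At u
      & root (piE_poly gA (rayleigh Rt v) (rayleigh Kt z) (rayleigh Et z)) lam].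

(* The condition gamma_A != 1 for the eigenvalue lam.  It cannot be asked of all
   Rayleigh quotients of At: they fill [gamma_min^A, gamma_max^A], which contains
   1 in its interior.  It concerns the indicator attached to lam through pi_E:
   only the lam reached by pi_E exclusively with gamma_A = 1 are excluded. *)
Definition gammaA_neq1 (lam : R) : Prop :=
  (exists gA, gammaA_at lam gA) -> exists2 gA, gammaA_at lam gA & gA != 1.

End Indicators.

(* Main.v *)
(** After scaling by [Ah^(-1/2)], [Sh^(-1/2)], [Xh^(-1/2)], and with [At], [Et]
    the scaled [A], [E] and [Rm := Sh^(-1/2) B Ah^(-1/2)], a vector [(x, y, z)] is
    an eigenvector for [l] iff
      [(At - l) x = (l - 1) Rm^T y],
      [(1 - l) Rm x - l (y + Rm Rm^T y) + (1 + l) K^T z = 0],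
      [(1 + l) K y + Et z - l (z + K K^T z) = 0].
    The matrix of this system is symmetric.  Eliminating [x] and then [y] leaves
    Schur complements whose sign is that of [p_poly], then of [piE_poly], with the
    indicators replaced by the extreme eigenvalues that are worst for the sign in
    question.  The matrix is positive definite to the left of [mu_a], negative
    definite to the right of the last interval, and quasi-definite between
    [lambda_minus] and the second interval: there the [x] and [z] blocks are
    positive and the [y] block is negative (at [l = 0] the [z] block is only
    semidefinite, but [K^T] is injective).  In all three regions it is regular. *)
Require Import Defs.
From mathcomp Require Import all_boot all_order all_algebra.
From mathcomp Require Import reals polyrcf complex.
From mathcomp Require Import ring lra.

Import Order.TTheory GRing.Theory Num.Theory.

Local Open Scope ring_scope.
Local Open Scope complex_scope.

Set Implicit Arguments.
Unset Strict Implicit.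

(** * Inner product of column vectors, and definite matrices *)

Section Dot.
Variable R : realType.

Definition dot n (u v : 'cV[R]_n) : R := (u^T *m v) 0 0.

Lemma dotE n (u v : 'cV[R]_n) : dot u v = \sum_i u i 0 * v i 0.
Proof. by rewrite /dot mxE; apply: eq_bigr => i _; rewrite mxE. Qed.

Lemma dotC n (u v : 'cV[R]_n) : dot u v = dot v u.
Proof. by rewrite !dotE; apply: eq_bigr => i _; rewrite mulrC. Qed.

Lemma dotDr n (u v w : 'cV[R]_n) : dot u (v + w) = dot u v + dot u w.
Proof. by rewrite /dot mulmxDr mxE. Qed.

Lemma dotZr n a (u v : 'cV[R]_n) : dot u (a *: v) = a * dot u v.
Proof. by rewrite /dot -scalemxAr mxE. Qed.

Lemma dotNr n (u v : 'cV[R]_n) : dot u (- v) = - dot u v.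
Proof. by rewrite /dot mulmxN mxE. Qed.

Lemma dotBr n (u v w : 'cV[R]_n) : dot u (v - w) = dot u v - dot u w.
Proof. by rewrite dotDr dotNr. Qed.

Lemma dotDl n (u v w : 'cV[R]_n) : dot (u + v) w = dot u w + dot v w.
Proof. by rewrite dotC dotDr !(dotC w). Qed.

Lemma dotZl n a (u v : 'cV[R]_n) : dot (a *: u) v = a * dot u v.
Proof. by rewrite dotC dotZr dotC. Qed.

Lemma dot0r n (u : 'cV[R]_n) : dot u 0 = 0.
Proof. by rewrite /dot mulmx0 mxE. Qed.

Lemma dot_mulmx n m (M : 'M[R]_(n, m)) u v : dot u (M *m v) = dot (M^T *m u) v.
Proof. by rewrite /dot trmx_mul trmxK mulmxA. Qed.

Lemma dot_ge0 n (u : 'cV[R]_n) : 0 <= dot u u.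
Proof. by rewrite dotE; apply: sumr_ge0 => i _; rewrite -expr2 sqr_ge0. Qed.

Lemma dot_eq0 n (u : 'cV[R]_n) : (dot u u == 0) = (u == 0).
Proof.
apply/eqP/eqP => [|->]; last exact: dot0r.
rewrite dotE => /eqP; rewrite psumr_eq0 => [/allP u0|i _]; last first.
  by rewrite -expr2 sqr_ge0.
apply/colP => i; rewrite mxE; apply/eqP.
by have := u0 i (mem_index_enum _); rewrite /= mulf_eq0 orbb.
Qed.

Lemma dot_gt0 n (u : 'cV[R]_n) : (0 < dot u u) = (u != 0).
Proof. by rewrite lt0r dot_eq0 dot_ge0 andbT. Qed.

Lemma spd_dot n (M : 'M[R]_n) (v : 'cV[R]_n) :
  spd_mx M -> v != 0 -> 0 < dot v (M *m v).
Proof. by case=> _ M_gt0 /M_gt0; rewrite -mulmxA. Qed.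

Lemma spsd_dot n (M : 'M[R]_n) (v : 'cV[R]_n) :
  spsd_mx M -> 0 <= dot v (M *m v).
Proof. by case=> _ /(_ v); rewrite -mulmxA. Qed.

Lemma unitmx_ker0 n (M : 'M[R]_n) :
  (forall v : 'cV[R]_n, M *m v = 0 -> v = 0) -> M \in unitmx.
Proof.
move=> ker0; rewrite -unitmx_tr unitmxE unitfE; apply/negP => /det0P[v v0 vM].
have /ker0/(congr1 trmx) : M *m v^T = 0.
  by rewrite -[M]trmxK -trmx_mul vM trmx0.
by rewrite trmxK trmx0 => /eqP; rewrite (negPf v0).
Qed.

Lemma spd_unit n (M : 'M[R]_n) : spd_mx M -> M \in unitmx.
Proof.
move=> M_spd; apply: unitmx_ker0 => v Mv0; apply/eqP/negPn/negP => v0.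
by have := spd_dot M_spd v0; rewrite Mv0 dot0r ltxx.
Qed.
End Dot.

(** * Spectral decomposition of real symmetric matrices *)

Section Spectral.
Variable R : realType.
Notation toC := (map_mx (real_complex R)).

Lemma eigenvalue_toC n (M : 'M[R]_n) a :
  eigenvalue (toC M) a%:C = eigenvalue M a.
Proof. by rewrite !eigenvalue_root_char -map_char_poly fmorph_root. Qed.

(** A real symmetric matrix is hermitian over [R[i]], hence unitarily diagonalizable. Its spectrum
    is real, so the diagonal descends to a real row [d], while [U] stays complex. *)
Lemma sym_spectral n (T : 'M[R]_n) : T^T = T ->
  exists (d : 'rV[R]_n) (U : 'M[R[i]]_n),
    U \is unitarymx /\ toC T = invmx U *m diag_mx (toC d) *m U.
Proof.
move=> T_sym.
have T_herm : toC T \is hermsymmx.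
  apply: realsym_hermsym.
    by apply/is_hermitianmxP; rewrite expr0 scale1r map_mx_id// map_trmx T_sym.
  by apply/mxOverP => i j; rewrite mxE; apply/complex_realP; exists (T i j).
have /mxOverP d_real := hermitian_spectral_diag_real T_herm.
exists (map_mx (@complex.Re R) (spectral_diag (toC T))), (spectralmx (toC T)).
split; first exact: spectral_unitarymx.
have -> : toC (map_mx (@complex.Re R) (spectral_diag (toC T)))
          = spectral_diag (toC T).
  by apply/rowP => i; rewrite !mxE RRe_real.
exact/orthomx_spectralP/hermitian_normalmx.
Qed.

(** In the coordinates [v *m invmx U] the matrix acts diagonally, so a nonzero coordinate [i] forces
    the eigenvalue to be [d 0 i]. *)
Lemma sym_eigenvalue_real n (T : 'M[R]_n) (a : R[i]) : T^T = T ->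
  eigenvalue (toC T) a -> exists2 l, a = l%:C & eigenvalue T l.
Proof.
move=> T_sym eig_a; have [d [U [U_unitary TE]]] := sym_spectral T_sym.
have U_unit := unitarymx_unit U_unitary.
have [v vT v0] := eigenvalueP eig_a.
suff [i ad] : exists i, a = (d 0 i)%:C.
  by exists (d 0 i); rewrite // -eigenvalue_toC -ad.
have /rV0Pn[i wi] : v *m invmx U != 0.
  by apply: contra v0 => /eqP/(congr1 (mulmx^~ U)); rewrite mulmxKV ?mul0mx // => ->.
exists i; move: vT; rewrite TE !mulmxA => /(congr1 (mulmx^~ (invmx U))).
rewrite mulmxK // -scalemxAl mul_mx_diag => /rowP/(_ i).
by rewrite [LHS]mxE [RHS]mxE mulrC [toC d _ _]mxE => /(mulIf wi) <-.
Qed.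

(** The weights are the squared moduli of the coordinates [y = U v]. They are real although [U] is
    complex, so a Rayleigh quotient becomes a weighted mean of real eigenvalues. *)
Lemma sym_rayleigh n (T : 'M[R]_n) (v : 'cV[R]_n) : T^T = T ->
  exists d w : 'I_n -> R,
    [/\ forall i, eigenvalue T (d i), forall i, 0 <= w i,
        dot v v = \sum_i w i & dot v (T *m v) = \sum_i d i * w i].
Proof.
move=> T_sym; have [d [U [U_unitary TE]]] := sym_spectral T_sym.
have U_unit := unitarymx_unit U_unitary.
pose y := U *m toC v.
(* [v] is real, so conjugation affects [U] alone, whose conjugate transpose is its inverse. *)
have ytE : (map_mx Num.conj y)^T = (toC v)^T *m invmx U.
  rewrite invmx_unitary // /y map_mxM trmx_mul; congr (_ *m _).
    by apply/matrixP => i j; rewrite !mxE; apply/CrealP/complex_realP; exists (v j i).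
  by apply/matrixP => i j; rewrite !mxE.
exists (fun i => d 0 i), (fun i => complex.Re (`|y i 0| ^+ 2)).
have wE i : (complex.Re (`|y i 0| ^+ 2))%:C = y i 0 * (y i 0)^*.
  by rewrite RRe_real ?realX ?normr_real // normCK.
split.
(* Row [i] of [U] is a left eigenvector; it is nonzero because [U] is invertible. *)
- move=> i; rewrite -eigenvalue_toC; apply/eigenvalueP; exists (row i U).
    rewrite TE !mulmxA -row_mul mulmxV // row1 -rowE row_diag_mx.
    by rewrite -scalemxAl -rowE mxE.
  apply/negP => /eqP/(congr1 (mulmx^~ (invmx U))).
  rewrite -row_mul mulmxV // row1 mul0mx => /rowP/(_ i).
  by rewrite !mxE !eqxx => /eqP; rewrite oner_eq0.
- by move=> i; rewrite -ler0c RRe_real ?realX ?normr_real // exprn_ge0.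
- apply: (@complexI R); rewrite rmorph_sum /=.
  under eq_bigr => i _ do rewrite wE.
  transitivity ((((map_mx Num.conj y)^T *m y)) 0 0); last first.
    by rewrite mxE; apply: eq_bigr => i _; rewrite !mxE mulrC.
  by rewrite ytE /y mulmxA mulmxKV // map_trmx -map_mxM mxE.
- apply: (@complexI R); rewrite rmorph_sum /=.
  under eq_bigr => i _ do rewrite rmorphM /= wE.
  transitivity ((((map_mx Num.conj y)^T *m (diag_mx (toC d) *m y))) 0 0); last first.
    rewrite mul_diag_mx mxE; apply: eq_bigr => i _.
    by rewrite !mxE mulrCA; congr (_ * _); apply: mulrC.
  rewrite ytE /y -mulmxA (mulmxA (diag_mx _)) (mulmxA (invmx U)).
  by rewrite (mulmxA (invmx U)) -TE map_trmx -!map_mxM mxE.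
Qed.
End Spectral.

(** * Ordered real roots of polynomials, and extreme eigenvalues *)

Section Roots.
Variable R : realType.
Implicit Types P : {poly R}.

Lemma mem_rootsR P x : P != 0 -> (x \in rootsR P) = root P x.
Proof. by move=> /roots_on_rootsR <-; rewrite andbC andbT. Qed.

Lemma sorted_rootsR P : sorted <%R (rootsR P).
Proof. exact: sorted_roots. Qed.

Lemma rootsR_eq P (s : seq R) :
  P != 0 -> sorted <%R s -> root P =i mem s -> rootsR P = s.
Proof.
move=> P0 s_sorted sE; apply: (irr_sorted_eq lt_trans) => //.
  exact: sorted_rootsR.
by move=> x; rewrite mem_rootsR // -[root P x]/(x \in root P) sE.
Qed.

(** The sign change on [(0, u)] gives the middle root [r2]. The quotient by [X - r2] is
    [X^2 + al X + be], and [P.[0] > 0] forces [be < 0], so its roots have opposite signs. The signs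
    of [P] at [l] and [u] then locate them. *)
Lemma cubic_rootsR P (a b c l u : R) :
    (forall x, P.[x] = x ^+ 3 + a * x ^+ 2 + b * x + c) ->
    l < 0 -> 0 <= P.[l] -> 0 < P.[0] -> 0 < u -> P.[u] < 0 ->
  exists r1 r2 r3, [/\ rootsR P = [:: r1; r2; r3], r1 <= l, 0 < r2 < u, u < r3
    & forall x, P.[x] = (x - r1) * (x - r2) * (x - r3)].
Proof.
move=> PE l_lt0 Pl P0 u_gt0 Pu.
have [|r2 r2_in /rootP Pr2] := @poly_ivtoo _ P 0 u (ltW u_gt0).
  by rewrite pmulr_rlt0.
have /andP[r2_gt0 r2_lt] : 0 < r2 < u by rewrite in_itv in r2_in.
pose al := a + r2; pose be := b + r2 * al.
have cE : c = - r2 * be.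
  by move: Pr2; rewrite PE /be /al => Pr2; lra.
have be_lt0 : be < 0.
  by move: P0; rewrite PE cE !expr0n /= !mulr0 !add0r mulNr oppr_gt0 pmulr_rlt0.
pose s := Num.sqrt (al ^+ 2 - 4 * be).
have disc_gt0 : 0 < al ^+ 2 - 4 * be by have := sqr_ge0 al; lra.
have s2 : s ^+ 2 = al ^+ 2 - 4 * be by rewrite sqr_sqrtr // ltW.
have s_gt0 : 0 < s by rewrite sqrtr_gt0.
pose r1 := (- al - s) / 2; pose r3 := (- al + s) / 2.
have r13 : r1 * r3 = be by rewrite /r1 /r3; field: s2.
have PF x : P.[x] = (x - r1) * (x - r2) * (x - r3).
  have -> : (x - r1) * (x - r2) * (x - r3)
    = (x - r2) * (x ^+ 2 - (r1 + r3) * x + r1 * r3) by ring.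
  have -> : r1 + r3 = - al by rewrite /r1 /r3; field.
  by rewrite r13 PE cE /be /al; ring.
have r1_lt_r3 : r1 < r3 by rewrite /r1 /r3; lra.
have [r1_lt0 r3_gt0] : r1 < 0 /\ 0 < r3.
  have : r1 * r3 < 0 by rewrite r13.
  by move=> r13_lt0; split; nra.
have r1_le : r1 <= l.
  move: Pl; rewrite PF -mulrA pmulr_lge0 ?subr_ge0 //.
  by rewrite nmulr_rgt0 subr_lt0; lra.
have r3_lt : u < r3.
  move: Pu; rewrite PF pmulr_rlt0 ?subr_lt0 //.
  by rewrite mulr_gt0 ?subr_gt0 //; lra.
exists r1, r2, r3; split => //.
apply: rootsR_eq.
- by apply: contraTneq P0 => ->; rewrite horner0 ltxx.
- by rewrite /= andbT; apply/andP; split; lra.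
move=> x; rewrite -[LHS]/(root P x) rootE PF !mulf_eq0 !subr_eq0 !inE orbA.
by [].
Qed.

Lemma eigenvalue_in_rootsR n (M : 'M[R]_n) a :
  (a \in rootsR (char_poly M)) = eigenvalue M a.
Proof. by rewrite mem_rootsR ?monic_neq0 ?char_poly_monic // eigenvalue_root_char. Qed.

Lemma eig_bounds n (M : 'M[R]_n) a : eigenvalue M a -> eig_min M <= a <= eig_max M.
Proof.
rewrite -eigenvalue_in_rootsR /eig_min /eig_max.
have := sorted_rootsR (char_poly M); case: (rootsR _) => //= x s s_sorted.
have x_le : all (>= x) (x :: s).
  rewrite /= lexx; apply: sub_all (order_path_min lt_trans s_sorted) => y.
  exact: ltW.
move=> a_in; rewrite (allP x_le) //=.
elim: s x a {x_le} s_sorted a_in => [|y s IHs] x a /=; first by rewrite inE => _ /eqP->.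
case/andP=> xy s_sorted; rewrite inE => /orP[/eqP->|]; last exact: IHs.
by apply: le_trans (ltW xy) (IHs y y s_sorted (mem_head _ _)).
Qed.

(** The given eigenvalue makes the root list nonempty, so that [head] does not return its default
    value 0. *)
Lemma eig_min_eigenvalue n (M : 'M[R]_n) a : eigenvalue M a -> eigenvalue M (eig_min M).
Proof.
rewrite -!eigenvalue_in_rootsR /eig_min.
by case: (rootsR _) => //= x s _; rewrite mem_head.
Qed.

(** * Extreme eigenvalues as bounds of a quadratic form *)

Section SymmetricEigenvalues.
Variables (n : nat) (N T : 'M[R]_n).
Hypothesis T_sym : T^T = T.
Hypothesis eig_NT : forall a, eigenvalue N a = eigenvalue T a.

(** The form of [T] is a nonnegative combination of eigenvalues. Two matrices occur because the
    extreme eigenvalues are those of a product [N] such as [invmx Ah *m A], while the form belongs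
    to its symmetric counterpart [T], such as [Aq *m A *m Aq], with the same eigenvalues. *)
Lemma dot_sym_bounds (v : 'cV[R]_n) :
  eig_min N * dot v v <= dot v (T *m v) <= eig_max N * dot v v.
Proof.
have [d [w [d_eig w_ge0 -> ->]]] := sym_rayleigh v T_sym.
have d_in i : eig_min N <= d i <= eig_max N by rewrite eig_bounds // eig_NT.
rewrite !mulr_sumr; apply/andP; split; apply: ler_sum => i _;
  by apply: ler_wpM2r => //; case/andP: (d_in i).
Qed.

Lemma eig_min_vector : (0 < n)%N ->
  exists2 v : 'cV[R]_n, v != 0 & T *m v = eig_min N *: v.
Proof.
(* The vector 0 is a dummy: the decomposition serves to exhibit one real eigenvalue. *)
move=> n_gt0; have [d [w [d_eig _ _ _]]] := sym_rayleigh 0 T_sym.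
have /eig_min_eigenvalue : eigenvalue N (d (Ordinal n_gt0)) by rewrite eig_NT.
rewrite eig_NT => /eigenvalueP[v vT v0]; exists v^T.
  by apply: contra v0 => /eqP/(congr1 trmx); rewrite trmxK trmx0 => /eqP.
by rewrite -{1}T_sym -trmx_mul vT linearZ.
Qed.

Lemma eig_min_gt0 : (0 < n)%N -> spd_mx T -> 0 < eig_min N.
Proof.
move=> n_gt0 T_spd; have [v v0 Tv] := eig_min_vector n_gt0.
have := spd_dot T_spd v0.
by rewrite Tv dotZr pmulr_lgt0 // dot_gt0.
Qed.

Lemma eig_max_gt0 : (0 < n)%N -> spd_mx T -> 0 < eig_max N.
Proof.
move=> n_gt0 T_spd; apply: lt_le_trans (eig_min_gt0 n_gt0 T_spd) _.
have [v v0 _] := eig_min_vector n_gt0.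
have /andP[min_le max_ge] := dot_sym_bounds v.
by rewrite -(ler_pM2r (_ : 0 < dot v v)) ?dot_gt0 // (le_trans min_le).
Qed.

Lemma eig_max_ge0 : (0 < n)%N -> spsd_mx T -> 0 <= eig_max N.
Proof.
move=> n_gt0 T_spsd; pose v : 'cV[R]_n := const_mx 1.
have v0 : 0 < dot v v.
  rewrite dot_gt0; apply/negP => /eqP/colP/(_ (Ordinal n_gt0)).
  by rewrite !mxE => /eqP; rewrite oner_eq0.
have /andP[_] := dot_sym_bounds v.
move=> /(le_trans (spsd_dot v T_spsd)).
by rewrite pmulr_lge0.
Qed.
End SymmetricEigenvalues.

End Roots.

(** * Roots and signs of [p_poly], [pi_poly] and [piE_poly] *)

Section Polynomials.
Variable R : realType.
Implicit Types gA gR gK gE x : R.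

Definition lambda_plus gA gR : R :=
  let eta := (gR + 1) * gA / 2 - gR in eta + Num.sqrt (eta ^+ 2 + gR).

Lemma horner_p_poly gA gR x :
  (p_poly gA gR).[x] = x ^+ 2 - (gA * gR + gA - 2 * gR) * x - gR.
Proof. by rewrite /p_poly !hornerE. Qed.

Lemma p_poly0 gA gR : (p_poly gA gR).[0] = - gR.
Proof. by rewrite horner_p_poly; ring. Qed.

Lemma horner_pi_poly gA gR gK x : (pi_poly gA gR gK).[x] =
  gK * ((1 + x) ^+ 2 * (gA - x)) + (1 + gK) * ((p_poly gA gR).[x] * x).
Proof. by rewrite /pi_poly !hornerE. Qed.

Lemma horner_piE_poly gA gR gK gE x : (piE_poly gA gR gK gE).[x] =
  (pi_poly gA gR gK).[x] - gE * (p_poly gA gR).[x].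
Proof. by rewrite /piE_poly !hornerE. Qed.

Lemma pi_polyE gA gR gK : pi_poly gA gR gK = piE_poly gA gR gK 0.
Proof. by rewrite /piE_poly scale0r subr0. Qed.

Section Signs.
Variables gA gR gK gE : R.
Hypotheses (gA_gt0 : 0 < gA) (gR_gt0 : 0 < gR).

Lemma p_poly_factor x : (p_poly gA gR).[x] =
  (x - lambda_minus gA gR) * (x - lambda_plus gA gR).
Proof.
rewrite horner_p_poly /lambda_minus /lambda_plus; set eta := (gR + 1) * gA / 2 - gR.
have : Num.sqrt (eta ^+ 2 + gR) ^+ 2 = eta ^+ 2 + gR.
  by rewrite sqr_sqrtr // addr_ge0 ?sqr_ge0 ?ltW.
move: (Num.sqrt _) => s s2; transitivity ((x - eta) ^+ 2 - (eta ^+ 2 + gR)).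
  by rewrite /eta; field.
by rewrite -s2; ring.
Qed.

Lemma lambda_minus_lt_plus : lambda_minus gA gR < lambda_plus gA gR.
Proof.
rewrite /lambda_minus /lambda_plus; set eta := (gR + 1) * gA / 2 - gR.
have : 0 < Num.sqrt (eta ^+ 2 + gR) by rewrite sqrtr_gt0 ltr_wpDl ?sqr_ge0.
by lra.
Qed.

Lemma p_poly_lt0 x :
  ((p_poly gA gR).[x] < 0) = (lambda_minus gA gR < x < lambda_plus gA gR).
Proof.
rewrite p_poly_factor; have lt_lam := lambda_minus_lt_plus.
apply/idP/andP => [h|[h1 h2]]; last by rewrite pmulr_rlt0 ?subr_gt0 ?subr_lt0.
by split; rewrite ltNge; apply/negP => ?; nra.
Qed.

Lemma lambda_minus_lt0 : lambda_minus gA gR < 0.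
Proof.
have : (p_poly gA gR).[0] < 0 by rewrite p_poly0 oppr_lt0.
by rewrite p_poly_lt0 => /andP[].
Qed.

Lemma lambda_plus_gt0 : 0 < lambda_plus gA gR.
Proof.
have : (p_poly gA gR).[0] < 0 by rewrite p_poly0 oppr_lt0.
by rewrite p_poly_lt0 => /andP[].
Qed.

(** This is where [gA != 1] enters: it makes the value negative, which puts [gA] strictly between
    the two roots of [p_poly]. *)
Lemma p_poly_gA : (p_poly gA gR).[gA] = - gR * (gA - 1) ^+ 2.
Proof. by rewrite horner_p_poly; ring. Qed.

Hypotheses (gA_neq1 : gA != 1) (gK_gt0 : 0 < gK) (gE_ge0 : 0 <= gE).

Lemma p_poly_gA_lt0 : (p_poly gA gR).[gA] < 0.
Proof. by rewrite p_poly_gA mulNr oppr_lt0 mulr_gt0 // exprn_even_gt0 // subr_eq0. Qed.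

Lemma gA_lt_lambda_plus : gA < lambda_plus gA gR.
Proof. by have := p_poly_gA_lt0; rewrite p_poly_lt0 => /andP[]. Qed.

(** At a root of [p_poly] the cubic reduces to [gK (1 + x)^2 (gA - x)]. This is nonnegative at
    [lambda_minus], where [1 + x] may vanish, and negative at [lambda_plus > gA]. At 0 the cubic
    equals [gK gA + gE gR > 0], and its leading coefficient is 1. *)
Lemma piE_poly_roots : exists r1 r2 r3,
  [/\ rootsR (piE_poly gA gR gK gE) = [:: r1; r2; r3],
      r1 <= lambda_minus gA gR, 0 < r2 < lambda_plus gA gR,
      lambda_plus gA gR < r3
    & forall x, (piE_poly gA gR gK gE).[x] = (x - r1) * (x - r2) * (x - r3)].
Proof.
pose q := gA * gR + gA - 2 * gR.
apply: (@cubic_rootsR _ _ (gK * (gA - 2) - (1 + gK) * q - gE)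
  (gK * (2 * gA - 1) - (1 + gK) * gR + gE * q) (gK * gA + gE * gR)).
- by move=> x; rewrite horner_piE_poly horner_pi_poly horner_p_poly /q; ring.
- exact: lambda_minus_lt0.
- rewrite horner_piE_poly horner_pi_poly p_poly_factor subrr !mul0r !mulr0 subr0 addr0.
  apply: mulr_ge0; first exact: ltW.
  by rewrite mulr_ge0 ?sqr_ge0 // subr_ge0 ltW // (lt_trans lambda_minus_lt0).
- rewrite horner_piE_poly horner_pi_poly p_poly0 !mulr0 subr0 !addr0 expr1n mul1r.
  by rewrite mulrN opprK ltr_pwDl ?mulr_gt0 // mulr_ge0 // ltW.
- exact: lambda_plus_gt0.
rewrite horner_piE_poly horner_pi_poly p_poly_factor subrr mulr0 mul0r !mulr0 subr0 addr0.
have lp_gt0 := lambda_plus_gt0.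
rewrite pmulr_rlt0 // pmulr_rlt0 ?subr_lt0 ?gA_lt_lambda_plus //.
by rewrite exprn_gt0 // addr_gt0.
Qed.

Lemma gt_muE_c x : muE_c gA gR gK gE < x ->
  [/\ 0 < (p_poly gA gR).[x], 0 < (piE_poly gA gR gK gE).[x] & gA < x].
Proof.
have [r1 [r2 [r3 [rE r1_le /andP[r2_gt0 r2_lt] r3_gt piEE]]]] := piE_poly_roots.
rewrite /muE_c rE /= => x_gt; have lt_lam := lambda_minus_lt_plus.
have gA_lt := gA_lt_lambda_plus.
split; last by lra.
  by rewrite p_poly_factor mulr_gt0 // subr_gt0; lra.
by rewrite piEE !mulr_gt0 // subr_gt0; lra.
Qed.

End Signs.

Lemma lt_mu_a gA gR gK x : 0 < gA -> 0 < gR -> gA != 1 -> 0 < gK ->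
  x < mu_a gA gR gK ->
  [/\ x < 0, 0 < (p_poly gA gR).[x] & (pi_poly gA gR gK).[x] < 0].
Proof.
move=> gA_gt0 gR_gt0 gA_neq1 gK_gt0; rewrite /mu_a pi_polyE.
have [r1 [r2 [r3 [-> r1_le /andP[r2_gt0 r2_lt] r3_gt piEE]]]] :=
  piE_poly_roots gA_gt0 gR_gt0 gA_neq1 gK_gt0 (lexx 0).
move=> /= x_lt; have lt_lam := lambda_minus_lt_plus gA gR_gt0.
have lam_lt0 := lambda_minus_lt0 gA gR_gt0.
split; first by lra.
  by rewrite p_poly_factor // nmulr_rgt0 subr_lt0; lra.
rewrite piEE nmulr_llt0 ?nmulr_rgt0 ?subr_lt0 //; lra.
Qed.

(** The cubic is positive between 0 and its middle root [r2]. Its value at [gA] is [(1 + gK) gA]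
    times the negative number [(p_poly gA gR).[gA]], so [gA] cannot lie below [r2]. *)
Lemma lt_muE_b gA gR gK x : 0 < gA -> 0 < gR -> gA != 1 -> 0 < gK ->
  0 < x < muE_b gA gR gK 0 -> x < gA /\ 0 < (pi_poly gA gR gK).[x].
Proof.
move=> gA_gt0 gR_gt0 gA_neq1 gK_gt0; rewrite /muE_b.
have lam_lt0 := lambda_minus_lt0 gA gR_gt0.
have [r1 [r2 [r3 [-> r1_le /andP[r2_gt0 r2_lt] r3_gt piEE]]]] :=
  piE_poly_roots gA_gt0 gR_gt0 gA_neq1 gK_gt0 (lexx 0).
have pi_gt0 y : 0 < y < r2 -> 0 < (pi_poly gA gR gK).[y].
  case/andP=> y_gt0 y_lt; rewrite pi_polyE piEE -mulrA mulr_gt0 //.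
    by rewrite subr_gt0; lra.
  by rewrite nmulr_rgt0 subr_lt0; lra.
move=> /= x_in; split; last exact: pi_gt0.
case/andP: x_in => x_gt0 x_lt; apply: lt_le_trans x_lt _.
rewrite leNgt; apply/negP => gA_lt.
have := pi_gt0 gA; rewrite gA_gt0 gA_lt => /(_ isT).
rewrite horner_pi_poly subrr !mulr0 add0r pmulr_rgt0; last by lra.
by rewrite pmulr_lgt0 // ltNge ltW // p_poly_gA_lt0.
Qed.

(** Beyond [betaE_c] this makes the coefficient [l - gE] of [|z|^2] positive in the definiteness
    argument. *)
Lemma le_betaE_c gE gK : 0 <= gE -> 0 <= gK -> gE <= betaE_c gE gK.
Proof.
move=> gE_ge0 gK_ge0; rewrite /betaE_c; set b := gK + _.
have b_ge0 : 0 <= b by rewrite /b; lra.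
have : b <= Num.sqrt (b ^+ 2 + gK).
  by rewrite -{1}[b]ger0_norm // -sqrtr_sqr ler_wsqrtr // lerDl.
by rewrite /b; lra.
Qed.
End Polynomials.

(** * Definiteness of quadratic forms in three blocks *)

Section DefiniteForms.
Variable R : realType.

Lemma dot_sqrD n (u v : 'cV[R]_n) a b :
  dot (a *: u + b *: v) (a *: u + b *: v)
  = a ^+ 2 * dot u u + 2 * a * b * dot u v + b ^+ 2 * dot v v.
Proof. by rewrite !dotDl !dotDr !dotZl !dotZr (dotC v u); ring. Qed.

(* Completing the square twice bounds the form below by a multiple of [|z|^2]. *)
Lemma block3_definite n m p (Rm : 'M[R]_(m, n)) (K : 'M[R]_(p, m))
    (x : 'cV[R]_n) (y : 'cV[R]_m) (z : 'cV[R]_p) (X Y Z b e g c d h k2 : R) :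
  let w := Rm^T *m y in let k := K^T *m z in
  0 < g -> 0 < c -> 0 < d -> 0 < d + h * k2 ->
  dot k k <= k2 * dot z z ->
  g * dot x x <= X -> c * dot y y <= Y - b ^+ 2 / g * dot w w ->
  d * dot z z + h * dot k k <= Z - e ^+ 2 / c * dot k k ->
  X + 2 * b * dot x w + Y + 2 * e * dot y k + Z = 0 ->
  [/\ x = 0, y = 0 & z = 0].
Proof.
move=> w k g_gt0 c_gt0 d_gt0 dh_gt0 kk_le X_ge Y_ge Z_ge sum0.
have sq1 := dot_ge0 (g *: x + b *: w).
have sq2 := dot_ge0 (c *: y + e *: k).
have e1 : dot (g *: x + b *: w) (g *: x + b *: w)
    = g * (g * dot x x + 2 * b * dot x w + b ^+ 2 / g * dot w w).
  by rewrite dot_sqrD; field; rewrite gt_eqF.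
have e2 : dot (c *: y + e *: k) (c *: y + e *: k)
    = c * (c * dot y y + 2 * e * dot y k + e ^+ 2 / c * dot k k).
  by rewrite dot_sqrD; field; rewrite gt_eqF.
rewrite e1 pmulr_rge0 // in sq1; rewrite e2 pmulr_rge0 // in sq2.
have zz_ge0 := dot_ge0 z; have kk_ge0 := dot_ge0 k.
have zz0 : dot z z = 0.
  apply/eqP; rewrite eq_le zz_ge0 andbT leNgt; apply/negP => zz_gt0.
  have : 0 < d * dot z z + h * dot k k.
    have [h_ge0|h_lt0] := leP 0 h.
      by rewrite ltr_wpDr ?mulr_ge0 ?mulr_gt0.
    have := ler_wnM2l (ltW h_lt0) kk_le; have := mulr_gt0 dh_gt0 zz_gt0.
    by rewrite mulrDl -mulrA; lra.
  by lra.
have z0 : z = 0 by apply/eqP; rewrite -dot_eq0 zz0.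
have k0 : k = 0 by rewrite /k z0 mulmx0.
rewrite zz0 k0 !(dot0r, mulr0, addr0, subr0) in Z_ge.
rewrite k0 !(dot0r, mulr0, addr0) in sq2 sum0.
have yy_ge0 := mulr_ge0 (ltW c_gt0) (dot_ge0 y).
have cyy0 : c * dot y y = 0 by lra.
have y0 : y = 0.
  by apply/eqP; rewrite -dot_eq0; move/eqP: cyy0; rewrite mulf_eq0 gt_eqF.
have w0 : w = 0 by rewrite /w y0 mulmx0.
rewrite w0 !(dot0r, mulr0, addr0) in sq1 sum0.
rewrite y0 w0 !(dot0r, mulr0, subr0) in Y_ge.
have gxx0 : g * dot x x = 0.
  have xx_ge0 := mulr_ge0 (ltW g_gt0) (dot_ge0 x); lra.
split => //; apply/eqP; rewrite -dot_eq0.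
by move/eqP: gxx0; rewrite mulf_eq0 gt_eqF.
Qed.

End DefiniteForms.

(** * Triviality of the kernel of the scaled system outside the intervals *)

Section ScaledSystem.
Variables (R : realType) (n m p : nat).
Variables (At : 'M[R]_n) (Rm : 'M[R]_(m, n)) (K : 'M[R]_(p, m)) (Et : 'M[R]_p).
Variables (x : 'cV[R]_n) (y : 'cV[R]_m) (z : 'cV[R]_p) (l : R).
(** Extreme eigenvalues: [a1], [a2] and [r1], [r2] are the smallest and largest for the indicators A
    and R, [k2] and [e2] the largest for K and E, and [x1] the smallest for X. *)
Variables (a1 a2 r1 r2 k2 e2 x1 : R).

Let w := Rm^T *m y.
Let k := K^T *m z.

Hypothesis At_sym : At^T = At.
Hypothesis At_bnd : forall v, a1 * dot v v <= dot v (At *m v) <= a2 * dot v v.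
Hypothesis Rm_bnd : forall v : 'cV[R]_m,
  r1 * dot v v <= dot (Rm^T *m v) (Rm^T *m v) <= r2 * dot v v.
Hypothesis K_bnd : forall v : 'cV[R]_p,
  dot (K^T *m v) (K^T *m v) <= k2 * dot v v.
Hypothesis E_bnd : forall v : 'cV[R]_p, 0 <= dot v (Et *m v) <= e2 * dot v v.
Hypothesis X_bnd : forall v : 'cV[R]_p,
  x1 * dot v v <= dot v (Et *m v) + dot (K^T *m v) (K^T *m v).
Hypothesis K_inj : forall v : 'cV[R]_p, K^T *m v = 0 -> v = 0.
Hypotheses (a1_gt0 : 0 < a1) (a1_lt1 : a1 < 1) (a2_gt1 : 1 < a2) (a2_lt2 : a2 < 2).
Hypotheses (r1_gt0 : 0 < r1) (r2_gt0 : 0 < r2) (k2_gt0 : 0 < k2).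
Hypotheses (e2_ge0 : 0 <= e2) (x1_gt0 : 0 < x1).

Hypothesis row1 : At *m x - l *: x = (l - 1) *: w.
Hypothesis row2 :
  (1 - l) *: (Rm *m x) - l *: (y + Rm *m w) + (1 + l) *: k = 0.
Hypothesis row3 :
  (1 + l) *: (K *m y) + Et *m z - l *: (z + K *m k) = 0.

Lemma row1_dot v :
  dot v (At *m x) - l * dot v x = (l - 1) * dot v w.
Proof. by rewrite -!dotZr -dotBr row1. Qed.

Lemma row2_dot v :
  (1 - l) * dot (Rm^T *m v) x - l * (dot v y + dot (Rm^T *m v) w)
  + (1 + l) * dot v k = 0.
Proof.
by have := congr1 (dot v) row2; rewrite dot0r dotDr dotBr !dotZr dotDr !dot_mulmx.
Qed.

Lemma row3_dot :
  (1 + l) * dot k y + dot z (Et *m z) - l * (dot z z + dot k k) = 0.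
Proof.
have := congr1 (dot z) row3.
by rewrite dot0r dotBr dotDr !dotZr dotDr (dot_mulmx K z y) (dot_mulmx K z k).
Qed.

Lemma ker_gt_muu :
  muE_c a2 r1 k2 e2 < l -> muE_c a2 r2 k2 e2 < l -> betaE_c e2 k2 < l ->
  [/\ x = 0, y = 0 & z = 0].
Proof.
move=> l_gt1 l_gt2 l_gtb; have a2_gt0 : 0 < a2 by apply: lt_trans a2_gt1.
have a2_neq1 : a2 != 1 by rewrite gt_eqF.
have l_e2 : e2 < l by apply: le_lt_trans l_gtb; rewrite le_betaE_c // ltW.
have [p1 pi1 a2_lt] := gt_muE_c a2_gt0 r1_gt0 a2_neq1 k2_gt0 e2_ge0 l_gt1.
have [p2 pi2 _] := gt_muE_c a2_gt0 r2_gt0 a2_neq1 k2_gt0 e2_ge0 l_gt2.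
have g_gt0 : 0 < l - a2 by lra.
(* The coefficient of [|w|^2] left after eliminating [x] can have either sign, so the worst value of
   the R indicator is [r1] or [r2]. Hence the two values of [muE_c] in the upper bound. *)
have [r [pr pir r_bnd]] : exists r, [/\ 0 < (p_poly a2 r).[l],
    0 < (piE_poly a2 r k2 e2).[l]
  & (l - (1 - l) ^+ 2 / (l - a2)) * r * dot y y
      <= (l - (1 - l) ^+ 2 / (l - a2)) * dot w w].
  have [h_ge0|h_lt0] := leP 0 (l - (1 - l) ^+ 2 / (l - a2)).
    by exists r1; split => //; rewrite -mulrA ler_wpM2l //; case/andP: (Rm_bnd y).
  exists r2; split => //; rewrite -mulrA (ler_wnM2l (ltW h_lt0)) //.
  by case/andP: (Rm_bnd y).
pose c := (p_poly a2 r).[l] / (l - a2).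
have c_gt0 : 0 < c by rewrite divr_gt0.
(* The form is taken with reversed sign. Here [c] bounds the [y] Schur complement from below, and
   [d + h * k2] is the [z] Schur complement at the extreme indicators, equal to [piE_poly] over
   [p_poly] at [l]. *)
apply: (@block3_definite R n m p Rm K x y z
  (l * dot x x - dot x (At *m x)) (l * (dot y y + dot w w))
  (l * (dot z z + dot k k) - dot z (Et *m z)) (l - 1) (- (1 + l)) (l - a2) c
  (l - e2) (l - (1 + l) ^+ 2 / c) k2) => //.
- by rewrite subr_gt0.
- rewrite [X in 0 < X](_ : _ = (piE_poly a2 r k2 e2).[l] / (p_poly a2 r).[l]).
    by rewrite divr_gt0.
  rewrite horner_piE_poly horner_pi_poly /c.
  by field; rewrite !gt_eqF.
- by have /andP[_] := At_bnd x; rewrite mulrBl; lra.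
- rewrite -/w -sqrrN opprB.
  have cE : c = (l - (1 - l) ^+ 2 / (l - a2)) * r + l.
    by rewrite /c horner_p_poly; field; rewrite gt_eqF.
  by rewrite cE mulrDl; lra.
- by rewrite -/k sqrrN; have /andP[_] := E_bnd z; lra.
have := row1_dot x; have := row2_dot y; have := row3_dot.
by rewrite -/w -/k (dotC w x) (dotC k y); lra.
Qed.

(** Here [Et] adds a nonnegative term to a block that has to be positive. It is bounded below by 0,
    so the sign is that of [pi_poly], without [gE]. *)
Lemma ker_lt_mu_a : l < mu_a a1 r2 k2 -> [/\ x = 0, y = 0 & z = 0].
Proof.
move=> l_lt; have a1_neq1 : a1 != 1 by rewrite lt_eqF.
have [l_lt0 p_gt0 pi_lt0] := lt_mu_a a1_gt0 r2_gt0 a1_neq1 k2_gt0 l_lt.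
have g_gt0 : 0 < a1 - l by rewrite subr_gt0 (lt_trans l_lt0).
pose c := (p_poly a1 r2).[l] / (a1 - l).
have c_gt0 : 0 < c by rewrite divr_gt0.
apply: (@block3_definite R n m p Rm K x y z
  (dot x (At *m x) - l * dot x x) (- l * (dot y y + dot w w))
  (dot z (Et *m z) - l * (dot z z + dot k k)) (1 - l) (1 + l) (a1 - l) c
  (- l) (- l - (1 + l) ^+ 2 / c) k2) => //.
- by rewrite oppr_gt0.
- rewrite [X in 0 < X](_ : _ = - (pi_poly a1 r2 k2).[l] / (p_poly a1 r2).[l]).
    by rewrite divr_gt0 // oppr_gt0.
  by rewrite horner_pi_poly /c; field; rewrite !gt_eqF.
- by have /andP[] := At_bnd x; rewrite mulrBl; lra.
- rewrite -/w.
  have cE : c = (- l - (1 - l) ^+ 2 / (a1 - l)) * r2 - l.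
    by rewrite /c horner_p_poly; field; rewrite gt_eqF.
  (* As [l < 0] and [a1 < 2], this coefficient of [|w|^2] is negative, so the worst case is the
     upper bound [r2]. *)
  have h_lt0 : - l - (1 - l) ^+ 2 / (a1 - l) < 0.
    rewrite [X in X < 0](_ : _ = - (1 + l * (a1 - 2)) / (a1 - l)); last first.
      by field; rewrite gt_eqF.
    rewrite pmulr_llt0 ?invr_gt0 // oppr_lt0 ltr_wpDr //.
    by rewrite mulr_le0 ?ltW // subr_lt0 (lt_trans a1_lt1) ?ltr1n.
  have /andP[_ /(ler_wnM2l (ltW h_lt0))] := Rm_bnd y.
  by rewrite cE mulrBl -/w; lra.
- by rewrite -/k; have /andP[] := E_bnd z; lra.
have := row1_dot x; have := row2_dot y; have := row3_dot.
by rewrite -/w -/k (dotC w x) (dotC k y); lra.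
Qed.

Let At_form v := dot v (At *m v) - l * dot v v.

Lemma At_form_bnd v : (a1 - l) * dot v v <= At_form v <= (a2 - l) * dot v v.
Proof. by rewrite /At_form !mulrBl !lerD2r At_bnd. Qed.

Lemma At_formD v t v' : At_form (v + t *: v') =
  At_form v + 2 * t * (dot v' (At *m v) - l * dot v' v) + t ^+ 2 * At_form v'.
Proof.
have vv' : dot v (At *m v') = dot v' (At *m v) by rewrite dot_mulmx At_sym dotC.
rewrite /At_form mulmxDr -scalemxAr !(dotDl, dotDr, dotZl, dotZr) vv' (dotC v v').
by ring.
Qed.

(** The form [X] of [At - l] at [x] is bounded twice: rows 2 and 3 give [X <= - l (|y|^2 + |w|^2)],
    and [At - l <= a2 - l] with row 1 gives [X >= (1 - l)^2 / (a2 - l) |w|^2]. Since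
    [|w|^2 >= r1 |y|^2] and [p_poly] is negative at [l], these force [y = 0]. *)
Lemma ker_gap_le0 : lambda_minus a2 r1 < l -> l <= 0 ->
  [/\ x = 0, y = 0 & z = 0].
Proof.
move=> l_gt l_le0.
have a2_gt0 : 0 < a2 by apply: lt_trans a2_gt1.
have p_lt0 : (p_poly a2 r1).[l] < 0.
  by rewrite p_poly_lt0 // l_gt (le_lt_trans l_le0) // lambda_plus_gt0.
have g_gt0 : 0 < a2 - l by rewrite subr_gt0 (le_lt_trans l_le0).
pose X := At_form x.
have XE : X = (l - 1) * dot x w by exact: row1_dot.
have eq2 := row2_dot y; have eq3 := row3_dot.
rewrite -/w (dotC w x) in eq2; rewrite (dotC k y) in eq3.
have yy_ge0 := dot_ge0 y; have ww_ge0 := dot_ge0 w.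
have zz_ge0 := dot_ge0 z; have kk_ge0 := dot_ge0 k.
have /andP[zEz_ge0 _] := E_bnd z.
have X_le : X <= - l * (dot y y + dot w w).
  have : 0 <= - l * (dot z z + dot k k) by rewrite mulr_ge0 ?addr_ge0 ?oppr_ge0.
  by lra.
(* This [t] minimizes the upper bound of [At_form (x + t *: w)], a quadratic in [t]; its
   nonnegativity replaces an estimate of the inverse of [At - l]. *)
pose t := (1 - l) / (a2 - l).
have X_ge : (1 - l) ^+ 2 / (a2 - l) * dot w w <= X.
  have : 0 <= At_form (x + t *: w).
    apply: le_trans (proj1 (andP (At_form_bnd _))).
    by rewrite mulr_ge0 ?dot_ge0 // subr_ge0 (le_trans l_le0) ?ltW.
  rewrite At_formD row1_dot -/X.
  have /andP[_ /(ler_wpM2l (sqr_ge0 t))] := At_form_bnd w.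
  have -> : t ^+ 2 * ((a2 - l) * dot w w) = (1 - l) ^+ 2 / (a2 - l) * dot w w.
    by rewrite /t; field; rewrite gt_eqF.
  have -> : 2 * t * ((l - 1) * dot w w) = - 2 * ((1 - l) ^+ 2 / (a2 - l) * dot w w).
    by rewrite /t; field; rewrite gt_eqF.
  by lra.
(* Positivity rests on [a2 < 2] together with [l <= 0]; it allows [|w|^2] to be replaced by
   [r1 |y|^2]. *)
have h_gt0 : 0 < (1 - l) ^+ 2 / (a2 - l) + l.
  rewrite [X in 0 < X](_ : _ = (1 + l * (a2 - 2)) / (a2 - l)); last first.
    by field; rewrite gt_eqF.
  by rewrite divr_gt0 // ltr_wpDr // mulr_le0 // subr_le0 ltW.
have cE : ((1 - l) ^+ 2 / (a2 - l) + l) * r1 + l = - (p_poly a2 r1).[l] / (a2 - l).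
  by rewrite horner_p_poly; field; rewrite gt_eqF.
have c_gt0 : 0 < ((1 - l) ^+ 2 / (a2 - l) + l) * r1 + l.
  by rewrite cE divr_gt0 // oppr_gt0.
have /andP[/(ler_wpM2l (ltW h_gt0)) ww_ge _] := Rm_bnd y.
rewrite -/w in ww_ge.
have cyy := mulr_ge0 (ltW c_gt0) yy_ge0.
have cyy0 : (((1 - l) ^+ 2 / (a2 - l) + l) * r1 + l) * dot y y = 0 by lra.
have y0 : y = 0.
  by apply/eqP; rewrite -dot_eq0; move/eqP: cyy0; rewrite mulf_eq0 gt_eqF.
have w0 : w = 0 by rewrite /w y0 mulmx0.
have X0 : X = 0 by rewrite XE w0 dot0r mulr0.
have x0 : x = 0.
  apply/eqP; rewrite -dot_eq0 eq_le dot_ge0 andbT.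
  have /andP[+ _] := At_bnd x; have := X0; rewrite /X /At_form => X0'.
  have xx_ge0 := dot_ge0 x; have := mulr_ge0 (ltW a1_gt0) xx_ge0.
  have : 0 <= - l * dot x x by rewrite mulr_ge0 ?oppr_ge0.
  by move=> ? ? ?; rewrite -(pmulr_rle0 _ a1_gt0); lra.
split => //.
move: l_le0; rewrite le_eqVlt => /orP[/eqP l0|l_lt0].
  apply: K_inj; have := row2; rewrite x0 w0 y0 l0 !mulmx0 !(scaler0, scale0r).
  by rewrite subr0 add0r addr0 scale1r.
apply/eqP; rewrite -dot_eq0 eq_le dot_ge0 andbT -oppr_ge0.
rewrite y0 dotC dot0r mulr0 add0r in eq3.
have lkk : 0 <= - l * dot k k by rewrite mulr_ge0 // oppr_ge0 ltW.
have l_gt0 : 0 < - l by rewrite oppr_gt0.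
by rewrite -(pmulr_rge0 _ l_gt0); lra.
Qed.

(* Schur complement in [y]: with [M := At - l], the matrix
   [N := (1 - l)^2 Rm M^-1 Rm^T + l (I + Rm Rm^T)] satisfies [N y = (1 + l) k]
   and [N <= c], hence [y^T N y >= (1 + l)^2 |k|^2 / c].  Testing [N] against [k]
   amounts to using the vector [x'] below. *)
Lemma ker_gap_gt0 : 0 < l -> l < x1 -> l < muE_b a1 r2 x1 0 ->
  [/\ x = 0, y = 0 & z = 0].
Proof.
move=> l_gt0 l_lt_x1 l_lt_mu; have a1_neq1 : a1 != 1 by rewrite lt_eqF.
have [|l_lt_a1 pi_gt0] := @lt_muE_b _ _ _ _ l a1_gt0 r2_gt0 a1_neq1 x1_gt0.
  by rewrite l_gt0.
have g_gt0 : 0 < a1 - l by rewrite subr_gt0.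
have form_ge0 v : 0 <= At_form v.
  apply: le_trans (proj1 (andP (At_form_bnd _))).
  by rewrite mulr_ge0 ?dot_ge0 // ltW.
have form_eq0 v : At_form v <= 0 -> v = 0.
  have /andP[form_ge _] := At_form_bnd v => /(le_trans form_ge).
  by rewrite pmulr_rle0 // => vv_le0; apply/eqP; rewrite -dot_eq0 eq_le vv_le0 dot_ge0.
pose M := At - l%:M; pose h := Rm^T *m k.
have M_mul v : M *m v = At *m v - l *: v by rewrite mulmxBl mul_scalar_mx.
have M_unit : M \in unitmx.
  apply: unitmx_ker0 => v; rewrite M_mul => Mv0; apply: form_eq0.
  by rewrite /At_form -dotZr -dotBr Mv0 dot0r.
(* [x'] solves the first row with [k] in place of [y]. *)
pose x' := (l - 1) *: (invmx M *m h).
have Mx' : At *m x' - l *: x' = (l - 1) *: h.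
  by rewrite -M_mul -scalemxAr mulKVmx.
pose X := At_form x; pose X' := At_form x'.
have XE : X = (l - 1) * dot x w by exact: row1_dot.
have X'E : X' = (l - 1) * dot x' h by rewrite /X' /At_form -dotZr -dotBr Mx' dotZr.
have cross : dot x' (At *m x) - l * dot x' x = (l - 1) * dot x h.
  by rewrite dot_mulmx At_sym dotC (dotC x') -dotZr -dotBr Mx' dotZr.
pose al := (1 - l) ^+ 2 / (a1 - l) + l.
pose c := al * r2 + l.
have al_gt0 : 0 < al by rewrite ltr_wpDl // divr_ge0 ?sqr_ge0 ?ltW.
have c_gt0 : 0 < c by rewrite addr_gt0 ?mulr_gt0.
have cE : c = - (p_poly a1 r2).[l] / (a1 - l).
  by rewrite /c /al horner_p_poly; field; rewrite gt_eqF.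
have form'_le : X' + l * (dot k k + dot h h) <= c * dot k k.
  have X'_le : X' <= (1 - l) ^+ 2 / (a1 - l) * dot h h.
    have /andP[form'_ge _] := At_form_bnd x'.
    (* Combined with [(a1 - l) |x'|^2 <= X'], this square yields the bound on [M^-1] that
       corresponds to [M >= a1 - l]. *)
    have := dot_ge0 ((a1 - l) *: x' + (1 - l) *: h); rewrite dot_sqrD.
    have -> : (a1 - l) ^+ 2 * dot x' x' + 2 * (a1 - l) * (1 - l) * dot x' h
        + (1 - l) ^+ 2 * dot h h
      = (a1 - l) * ((a1 - l) * dot x' x' - 2 * X'
        + (1 - l) ^+ 2 / (a1 - l) * dot h h).
      by rewrite X'E; field; rewrite gt_eqF.
    by rewrite pmulr_rge0 // /X' => ?; lra.
  have /andP[_ /(ler_wpM2l (ltW al_gt0))] := Rm_bnd k; rewrite -/h => h_le.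
  by rewrite /c mulrDl; move: h_le; rewrite /al; lra.
have eq2 := row2_dot y; have eq2' := row2_dot k; have eq3 := row3_dot.
rewrite -/w (dotC w x) in eq2; rewrite -/h (dotC h x) (dotC h w) in eq2'.
rewrite (dotC k y) in eq3 eq2'.
(* [Q] is [y^T N y]; row 2 identifies it with [(1 + l) dot y k]. *)
pose Q := X + l * (dot y y + dot w w).
have QE : Q = (1 + l) * dot y k by rewrite /Q XE; lra.
have zz_ge0 := dot_ge0 z; have kk_ge0 := dot_ge0 k.
have /andP[zEz_ge0 _] := E_bnd z.
(* The minimizer of [Q + 2 t (1 + l) |k|^2 + t^2 c |k|^2], which bounds the form of [N] at [y + t k]
   from above. *)
pose t := - (1 + l) / c.
have Q_ge : (1 + l) ^+ 2 / c * dot k k <= Q.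
  have : 0 <= At_form (x + t *: x') + l * dot (y + t *: k) (y + t *: k)
      + l * dot (w + t *: h) (w + t *: h).
    by do 2?[apply: addr_ge0; last exact: mulr_ge0 (ltW l_gt0) (dot_ge0 _)].
  have := dot_sqrD y k 1 t; have := dot_sqrD w h 1 t; rewrite !scale1r => -> ->.
  rewrite At_formD cross -/X -/X'.
  have := ler_wpM2l (sqr_ge0 t) form'_le.
  have -> : t ^+ 2 * (c * dot k k) = (1 + l) ^+ 2 / c * dot k k.
    by rewrite /t; field; rewrite gt_eqF.
  have eqt : 2 * t * ((l - 1) * dot x h) + 2 * t * l * (dot y k + dot w h)
      = - 2 * ((1 + l) ^+ 2 / c * dot k k).
    transitivity (2 * t * ((1 + l) * dot k k)); last first.
      by rewrite /t; field; rewrite gt_eqF.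
    have -> : (1 + l) * dot k k = (l - 1) * dot x h + l * (dot y k + dot w h) by lra.
    by ring.
  by rewrite /Q; lra.
pose g := (1 + l) ^+ 2 / c - l.
have g_bnd : l < x1 * g.
  rewrite -subr_gt0 [X in 0 < X](_ : _ = (pi_poly a1 r2 x1).[l] / (c * (a1 - l))).
    by rewrite divr_gt0 // mulr_gt0.
  rewrite horner_pi_poly (_ : (p_poly a1 r2).[l] = - (c * (a1 - l))); last first.
    by rewrite cE; field; rewrite gt_eqF.
  by rewrite /g; field; rewrite !gt_eqF.
have g_gt0' : 0 < g by rewrite -(pmulr_rgt0 _ x1_gt0) (lt_trans l_gt0).
have zEz_le : dot z (Et *m z) + g * dot k k <= l * dot z z.
  by rewrite /g mulrBl; lra.
have z0 : z = 0.
  apply/eqP; rewrite -dot_eq0 eq_le zz_ge0 andbT leNgt; apply/negP => zz_gt0.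
  have := X_bnd z; rewrite -/k => X_z.
  have lt1 : l * dot z z < x1 * g * dot z z by rewrite ltr_pM2r.
  have lt2 : l * dot z z < x1 * dot z z by rewrite ltr_pM2r.
  (* The two cases account for the two terms of the lower bound [mul]. If [g >= 1], the left side of
     [zEz_le] is at least [x1 |z|^2], and [l < x1] contradicts it. If [g < 1], it is at least
     [g x1 |z|^2], and the sign of [pi_poly] gives [l < x1 g]. *)
  have [g_ge1|g_lt1] := leP 1 g.
    by have := ler_wpM2r kk_ge0 g_ge1; lra.
  have := ler_wpM2l (ltW g_gt0') X_z; have := ler_wpM2r zEz_ge0 (ltW g_lt1).
  by lra.
have k0 : k = 0 by rewrite /k z0 mulmx0.
have Q0 : Q = 0 by rewrite QE k0 dot0r mulr0.
have yy_ge0 := dot_ge0 y; have ww_ge0 := mulr_ge0 (ltW l_gt0) (dot_ge0 w).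
have X_ge0 : 0 <= X by exact: form_ge0.
have lyy_ge0 := mulr_ge0 (ltW l_gt0) yy_ge0.
move: Q0; rewrite /Q mulrDr => Q0.
split => //; first by apply: form_eq0; rewrite -/X; lra.
by apply/eqP; rewrite -dot_eq0 eq_le yy_ge0 andbT -(pmulr_rle0 _ l_gt0); lra.
Qed.

End ScaledSystem.

(** * From the preconditioned eigenproblem to the scaled system *)

Section Reduction.
Variable R : realType.
Notation toC := (map_mx (real_complex R)).

Lemma invmx_mul (F : fieldType) n (P Q : 'M[F]_n) : P \in unitmx -> Q \in unitmx ->
  invmx (P *m Q) = invmx Q *m invmx P.
Proof.
move=> P_unit Q_unit; have PQ_unit : P *m Q \in unitmx by rewrite unitmx_mul P_unit.
by rewrite -[RHS]mul1mx -(mulVmx PQ_unit) -!mulmxA mulKVmx // mulmxV // mulmx1.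
Qed.

Lemma eigenvalue_conjugate (F : fieldType) n (P M : 'M[F]_n) a : P \in unitmx ->
  eigenvalue (invmx P *m M *m P) a = eigenvalue M a.
Proof.
move=> P_unit; apply/eigenvalueP/eigenvalueP => -[v vM v0].
  exists (v *m invmx P); first by rewrite scalemxAl -vM !mulmxA mulmxK.
  by apply: contra v0 => /eqP/(congr1 (mulmx^~ P)); rewrite mulmxKV ?mul0mx // => ->.
exists (v *m P); first by rewrite scalemxAl -vM !mulmxA mulmxK.
by apply: contra v0 => /eqP/(congr1 (mulmx^~ (invmx P))); rewrite mulmxK ?mul0mx // => ->.
Qed.

Lemma eigenvalue_sandwich n (Q M : 'M[R]_n) a : Q \in unitmx ->
  eigenvalue (Q *m Q *m M) a = eigenvalue (Q *m M *m Q) a.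
Proof.
move=> Q_unit; rewrite -[RHS](@eigenvalue_conjugate _ _ (invmx Q)) ?unitmx_inv //.
by rewrite invmxK !mulmxA mulmxK.
Qed.

(** The factorization [G *m G^T] makes the matrix similar to the symmetric [T], so its complex
    eigenvalues are real and have real eigenvectors. *)
Lemma eigenvalue_generalized n (G A : 'M[R]_n) (a : R[i]) :
    G \in unitmx -> A^T = A ->
    eigenvalue (toC (invmx (G *m G^T) *m A)) a ->
  exists2 l, a = l%:C &
    exists2 u : 'cV[R]_n, u != 0 & A *m u = l *: (G *m (G^T *m u)).
Proof.
move=> G_unit A_sym; have Gt_unit : G^T \in unitmx by rewrite unitmx_tr.
pose T := invmx G *m A *m invmx G^T.
have T_sym : T^T = T by rewrite /T !trmx_mul -!trmx_inv trmxK A_sym mulmxA.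
have -> : invmx (G *m G^T) *m A = invmx G^T *m T *m G^T.
  by rewrite /T !mulmxA mulmxKV // invmx_mul.
have toC_conj S : toC (invmx G^T *m S *m G^T)
    = invmx (toC G^T) *m toC S *m toC G^T by rewrite !map_mxM map_invmx.
rewrite toC_conj eigenvalue_conjugate ?map_unitmx //.
case/(sym_eigenvalue_real T_sym) => l al /eigenvalueP[s sT s0]; exists l => //.
(* Eigenvectors are rows in [eigenvalueP]; symmetry of [A] turns the row equation into one for
   columns. *)
exists (s *m invmx G)^T.
  apply: contra s0 => /eqP/(congr1 trmx); rewrite trmxK trmx0.
  by move=> /(congr1 (mulmx^~ G)); rewrite mulmxKV ?mul0mx // => ->.
have sA : s *m invmx G *m A = l *: (s *m G^T).
  by rewrite scalemxAl -sT /T !mulmxA mulmxKV.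
by rewrite -{1}A_sym -!trmx_mul mulmxKV // sA linearZ /= trmx_mul trmxK.
Qed.

Lemma mul_block3_col n m p
    (M11 : 'M[R]_n) (M12 : 'M[R]_(n, m)) (M13 : 'M[R]_(n, p))
    (M21 : 'M[R]_(m, n)) (M22 : 'M[R]_m) (M23 : 'M[R]_(m, p))
    (M31 : 'M[R]_(p, n)) (M32 : 'M[R]_(p, m)) (M33 : 'M[R]_p)
    (x : 'cV[R]_n) (y : 'cV[R]_m) (z : 'cV[R]_p) :
  block3_mx M11 M12 M13 M21 M22 M23 M31 M32 M33 *m col_mx (col_mx x y) z
  = col_mx (col_mx (M11 *m x + M12 *m y + M13 *m z) (M21 *m x + M22 *m y + M23 *m z))
           (M31 *m x + M32 *m y + M33 *m z).
Proof.
by rewrite /block3_mx !mul_block_col mul_col_mx add_col_mx mul_row_col.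
Qed.

Lemma tr_block3_mx n m p
    (M11 : 'M[R]_n) (M12 : 'M[R]_(n, m)) (M13 : 'M[R]_(n, p))
    (M21 : 'M[R]_(m, n)) (M22 : 'M[R]_m) (M23 : 'M[R]_(m, p))
    (M31 : 'M[R]_(p, n)) (M32 : 'M[R]_(p, m)) (M33 : 'M[R]_p) :
  (block3_mx M11 M12 M13 M21 M22 M23 M31 M32 M33)^T
  = block3_mx M11^T M21^T M31^T M12^T M22^T M32^T M13^T M23^T M33^T.
Proof. by rewrite /block3_mx !tr_block_mx tr_col_mx tr_row_mx. Qed.

(** [precond_D] serves as the general block diagonal matrix, also for the inverse square roots. *)
Lemma precond_DM n m p (A A' : 'M[R]_n) (S S' : 'M[R]_m) (X X' : 'M[R]_p) :
  precond_D A S X *m precond_D A' S' X' = precond_D (A *m A') (S *m S') (X *m X').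
Proof.
rewrite /precond_D /block3_mx !mulmx_block.
by rewrite !col_mx0 !row_mx0 !(mulmx0, mul0mx, addr0, add0r).
Qed.

Lemma precond_D1 n m p : precond_D 1%:M 1%:M 1%:M = 1%:M :> 'M[R]_(n + m + p).
Proof. by rewrite /precond_D /block3_mx col_mx0 row_mx0 -!scalar_mx_block. Qed.

Lemma invmx_precond_D n m p (A : 'M[R]_n) (S : 'M[R]_m) (X : 'M[R]_p) :
    A \in unitmx -> S \in unitmx -> X \in unitmx ->
  precond_D A S X \in unitmx /\
  invmx (precond_D A S X) = precond_D (invmx A) (invmx S) (invmx X).
Proof.
move=> A_unit S_unit X_unit.
have DV : precond_D A S X *m precond_D (invmx A) (invmx S) (invmx X) = 1%:M.
  by rewrite precond_DM !mulmxV // precond_D1.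
have [D_unit _] := mulmx1_unit DV; split => //.
by rewrite -[LHS]mulmx1 -DV mulKmx.
Qed.

Lemma precond_L_unit n m p (B : 'M[R]_(m, n)) (C : 'M[R]_(p, m))
    (A : 'M[R]_n) (S : 'M[R]_m) (X : 'M[R]_p) :
    A \in unitmx -> S \in unitmx -> X \in unitmx ->
  precond_L B C A S X \in unitmx.
Proof.
move=> A_unit S_unit X_unit; rewrite unitmxE /precond_L /block3_mx col_mx0.
by rewrite !det_lblock !unitrM -!unitmxE -scaleN1r A_unit X_unit unitmxZ ?S_unit ?unitrN1.
Qed.

Lemma spd_invsqrt n (M Q : 'M[R]_n) : spd_mx M -> is_invsqrt M Q ->
  [/\ Q^T = Q, Q \in unitmx, invmx M = Q *m Q & Q *m M *m Q = 1%:M].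
Proof.
move=> M_spd [Q_spd QQ]; have Q_unit := spd_unit Q_spd; have M_unit := spd_unit M_spd.
split=> //; first by case: Q_spd.
by apply: mulmx1C; rewrite mulmxA QQ mulVmx.
Qed.

Lemma spd_sandwich n (M Q : 'M[R]_n) : spd_mx M -> Q^T = Q -> Q \in unitmx ->
  spd_mx (Q *m M *m Q).
Proof.
move=> M_spd Q_sym Q_unit; have [M_sym M_gt0] := M_spd.
split=> [|v v0]; first by rewrite !trmx_mul M_sym Q_sym mulmxA.
rewrite -(mulmxA v^T) -[X in 0 < X]/(dot v (_ *m v)) -!mulmxA dot_mulmx Q_sym.
apply: spd_dot => //; apply: contra v0 => /eqP/(congr1 (mulmx (invmx Q))).
by rewrite mulKmx // mulmx0 => ->.
Qed.

Lemma spsd_sandwich n (M Q : 'M[R]_n) : spsd_mx M -> Q^T = Q ->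
  spsd_mx (Q *m M *m Q).
Proof.
move=> M_spsd Q_sym; have [M_sym M_ge0] := M_spsd.
split=> [|v]; first by rewrite !trmx_mul M_sym Q_sym mulmxA.
rewrite -(mulmxA v^T) -[X in 0 <= X]/(dot v (_ *m v)) -!mulmxA dot_mulmx Q_sym.
exact: spsd_dot.
Qed.

Lemma dot_gram n m (G : 'M[R]_(n, m)) v :
  dot v (G *m G^T *m v) = dot (G^T *m v) (G^T *m v).
Proof. by rewrite -mulmxA dot_mulmx. Qed.

Lemma spd_gram n m (G : 'M[R]_(n, m)) :
  (forall v : 'cV[R]_n, G^T *m v = 0 -> v = 0) -> spd_mx (G *m G^T).
Proof.
move=> G_inj; split=> [|v v0]; first by rewrite trmx_mul trmxK.
rewrite -(mulmxA v^T) -[X in 0 < X]/(dot v (_ *m v)) dot_gram dot_gt0.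
by apply: contra v0 => /eqP/G_inj ->.
Qed.

Lemma row_free_tr_inj n m (G : 'M[R]_(n, m)) (v : 'cV[R]_n) :
  row_free G -> G^T *m v = 0 -> v = 0.
Proof.
move=> G_free /(congr1 trmx); rewrite trmx_mul trmxK trmx0 => /eqP.
by rewrite mulmx_free_eq0 // => /eqP/(congr1 trmx); rewrite trmxK trmx0.
Qed.

Lemma unit_inj n (Q : 'M[R]_n) (v : 'cV[R]_n) : Q \in unitmx -> Q *m v = 0 -> v = 0.
Proof. by move=> Q_unit /(congr1 (mulmx (invmx Q))); rewrite mulKmx // mulmx0. Qed.

Lemma row_free_sandwich_tr_inj n m (P : 'M[R]_n) (Q : 'M[R]_m) (G : 'M[R]_(n, m))
    (v : 'cV[R]_n) : P^T = P -> P \in unitmx -> Q^T = Q -> Q \in unitmx ->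
  row_free G -> (P *m G *m Q)^T *m v = 0 -> v = 0.
Proof.
move=> P_sym P_unit Q_sym Q_unit G_free; rewrite !trmx_mul P_sym Q_sym -!mulmxA.
by move/(unit_inj Q_unit)/(row_free_tr_inj G_free)/(unit_inj P_unit).
Qed.

(** This lemma and the next two regroup terms, entry by entry, to bring the rows of the generalized
    problem to their symmetric form. *)
Lemma scaled_row1 n (a w x : 'cV[R]_n) l :
  a + w = l *: (x + w) -> a - l *: x = (l - 1) *: w.
Proof.
by move=> e; apply/colP => i; have /colP/(_ i) := e; rewrite !mxE; lra.
Qed.

Lemma scaled_row2 n (r k y s : 'cV[R]_n) l : r + k = l *: (r + s + (y - k)) ->
  (1 - l) *: r - l *: (y + s) + (1 + l) *: k = 0.
Proof.
by move=> e; apply/colP => i; have /colP/(_ i) := e; rewrite !mxE; lra.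
Qed.

Lemma scaled_row3 n (c e q z : 'cV[R]_n) l : c + e = l *: (- c + q + z) ->
  (1 + l) *: c + e - l *: (z + q) = 0.
Proof.
by move=> eq; apply/colP => i; have /colP/(_ i) := eq; rewrite !mxE; lra.
Qed.

Lemma scaled_system n m p (A Ah Aq : 'M[R]_n) (B : 'M[R]_(m, n))
    (C : 'M[R]_(p, m)) (E Xh Xq : 'M[R]_p) (Sh Sq : 'M[R]_m) (lam : R[i]) :
    A^T = A -> E^T = E ->
    spd_mx Ah -> spd_mx Sh -> spd_mx Xh ->
    is_invsqrt Ah Aq -> is_invsqrt Sh Sq -> is_invsqrt Xh Xq ->
    eigenvalue (toC (invmx (precond B C Ah Sh Xh) *m saddle_mx A B C E)) lam ->
  let Rm := Sq *m B *m Aq in let K := Xq *m C *m Sq in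
  exists2 l, lam = l%:C & exists (x : 'cV[R]_n) (y : 'cV[R]_m) (z : 'cV[R]_p),
    [/\ ~ [/\ x = 0, y = 0 & z = 0],
        Aq *m A *m Aq *m x - l *: x = (l - 1) *: (Rm^T *m y),
        (1 - l) *: (Rm *m x) - l *: (y + Rm *m (Rm^T *m y))
          + (1 + l) *: (K^T *m z) = 0
      & (1 + l) *: (K *m y) + Xq *m E *m Xq *m z
          - l *: (z + K *m (K^T *m z)) = 0].
Proof.
move=> A_sym E_sym Ah_spd Sh_spd Xh_spd Aq_def Sq_def Xq_def eig_lam Rm K.
have [Aq_sym Aq_unit Ah_inv Aq1] := spd_invsqrt Ah_spd Aq_def.
have [Sq_sym Sq_unit Sh_inv Sq1] := spd_invsqrt Sh_spd Sq_def.
have [Xq_sym Xq_unit Xh_inv Xq1] := spd_invsqrt Xh_spd Xq_def.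
have [Ah_unit Sh_unit Xh_unit] := And3 (spd_unit Ah_spd) (spd_unit Sh_spd)
  (spd_unit Xh_spd).
pose D := precond_D Aq Sq Xq; pose L := precond_L B C Ah Sh Xh.
have D_sym : D^T = D by rewrite /D /precond_D tr_block3_mx !trmx0 Aq_sym Sq_sym Xq_sym.
have [_ PD_inv] := invmx_precond_D Ah_unit Sh_unit Xh_unit.
(* [D *m D] is the inverse of the block diagonal factor, so the preconditioner has the form
   [G *m G^T] with [G = L *m D]. *)
have PE : precond B C Ah Sh Xh = (L *m D) *m (L *m D)^T.
  rewrite /precond PD_inv Ah_inv Sh_inv Xh_inv -precond_DM -/D -/L.
  by rewrite trmx_mul D_sym !mulmxA.
have G_unit : L *m D \in unitmx.
  rewrite unitmx_mul precond_L_unit //=.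
  by have [] := invmx_precond_D Aq_unit Sq_unit Xq_unit.
have S_sym : (saddle_mx A B C E)^T = saddle_mx A B C E.
  by rewrite /saddle_mx tr_block3_mx !trmx0 !trmxK A_sym E_sym.
move: eig_lam; rewrite PE => /(eigenvalue_generalized G_unit S_sym).
case=> l -> [u u0 uE]; exists l => //.
rewrite -[u]vsubmxK -[usubmx u]vsubmxK in u0 uE.
move: (usubmx (usubmx u)) (dsubmx (usubmx u)) (dsubmx u) u0 uE => u1 u2 u3 {u} u0 uE.
rewrite trmx_mul D_sym -!mulmxA (mulmxA D D) precond_DM -Ah_inv -Sh_inv -Xh_inv in uE.
have [Ah_sym _] := Ah_spd; have [Sh_sym _] := Sh_spd; have [Xh_sym _] := Xh_spd.
move: uE; rewrite /saddle_mx /L /precond_L /precond_D tr_block3_mx !mul_block3_col.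
rewrite !trmx0 Ah_sym Xh_sym !(mul0mx, addr0, add0r) !scale_col_mx.
rewrite (mulKVmx Ah_unit) (mulKVmx Xh_unit) [(- Sh)^T]linearN /= Sh_sym.
rewrite !mulmxDr !mulNmx !mulmxN !(mulKVmx Sh_unit) !(mulKmx Sh_unit, mulKmx Ah_unit).
rewrite opprK.
case/eq_col_mx => /eq_col_mx[eq1 eq2] eq3.
(* Change of variables [u = D (x, y, z)]. Multiplying the rows by [Aq], [Sq], [Xq] as well turns the
   diagonal blocks into identities. *)
have [x u1E] : exists x, u1 = Aq *m x by exists (invmx Aq *m u1); rewrite mulKVmx.
have [y u2E] : exists y, u2 = Sq *m y by exists (invmx Sq *m u2); rewrite mulKVmx.
have [z u3E] : exists z, u3 = Xq *m z by exists (invmx Xq *m u3); rewrite mulKVmx.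
have RmtE : Rm^T = Aq *m B^T *m Sq by rewrite /Rm !trmx_mul Aq_sym Sq_sym mulmxA.
have KtE : K^T = Sq *m C^T *m Xq by rewrite /K !trmx_mul Xq_sym Sq_sym mulmxA.
exists x, y, z; split.
- case=> x0 y0 z0; case/negP: u0.
  by rewrite u1E u2E u3E x0 y0 z0 !mulmx0 !col_mx0.
- have := congr1 (mulmx Aq) eq1; rewrite -scalemxAr !mulmxDr u1E u2E !mulmxA Aq1 mul1mx.
  by rewrite -RmtE; apply: scaled_row1.
- have := congr1 (mulmx Sq) eq2; rewrite -scalemxAr !mulmxDr !mulmxN u1E u2E u3E.
  rewrite Ah_inv !mulmxA Sq1 mul1mx -KtE -/Rm.
  have -> : Rm *m Aq *m B^T *m Sq = Rm *m Rm^T by rewrite RmtE !mulmxA.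
  exact: scaled_row2.
- have := congr1 (mulmx Xq) eq3; rewrite -scalemxAr !mulmxDr !mulmxN u2E u3E.
  rewrite Sh_inv !mulmxA Xq1 mul1mx -/K.
  have -> : K *m Sq *m C^T *m Xq = K *m K^T by rewrite KtE !mulmxA.
  exact: scaled_row3.
Qed.

End Reduction.

(** * Localization of the spectrum *)

Unset Implicit Arguments.

Theorem theorem3p1 (R : realType) (n m p : nat)
    (p_gt0 : (0 < p)%N) (le_pm : (p <= m)%N) (le_mn : (m <= n)%N)
    (A : 'M[R]_n) (B : 'M[R]_(m, n)) (C : 'M[R]_(p, m)) (E : 'M[R]_p)
    (A_spd : spd_mx A) (B_full : row_free B) (C_full : row_free C)
    (E_spsd : spsd_mx E)
    (Ah : 'M[R]_n) (Sh : 'M[R]_m) (Xh : 'M[R]_p)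
    (Ah_spd : spd_mx Ah) (Sh_spd : spd_mx Sh) (Xh_spd : spd_mx Xh)
    (Aq : 'M[R]_n) (Sq : 'M[R]_m) (Xq : 'M[R]_p)
    (Aq_def : is_invsqrt Ah Aq) (Sq_def : is_invsqrt Sh Sq)
    (Xq_def : is_invsqrt Xh Xq) :
  let St := Stilde B Ah in
  let Xt := Xtilde C E Sh in
  let K := Xq *m C *m Sq in
  let minA := eig_min (invmx Ah *m A) in
  let maxA := eig_max (invmx Ah *m A) in
  let minR := eig_min (invmx Sh *m St) in
  let maxR := eig_max (invmx Sh *m St) in
  let minX := eig_min (invmx Xh *m Xt) in
  let maxX := eig_max (invmx Xh *m Xt) in
  let maxE := eig_max (invmx Xh *m E) in
  let maxK := eig_max (K *m K^T) in
  minA < 1 -> 1 < maxA -> maxA < 2 ->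
  minR <= 1 <= maxR ->
  minX <= 1 <= maxX ->
  E != 0 ->
  let mul := Num.min minX (muE_b minA maxR minX 0) in
  let muu := Num.max (muE_c maxA minR maxK maxE)
               (Num.max (muE_c maxA maxR maxK maxE) (betaE_c maxE maxK)) in
  forall lam : R[i],
    eigenvalue (map_mx (real_complex R)
                  (invmx (precond B C Ah Sh Xh) *m saddle_mx A B C E)) lam ->
    exists2 l : R, lam = l%:C &
      gammaA_neq1 (Aq *m A *m Aq) (Sq *m St *m Sq) (K *m K^T) (Xq *m E *m Xq) l ->
      (l \in `[mu_a minA maxR maxK, lambda_minus maxA minR])
        || (l \in `[mul, muu]).
Proof.
move=> St Xt K minA maxA minR maxR minX maxX maxE maxK.
move=> minA_lt1 maxA_gt1 maxA_lt2 _ _ _ mul muu lam eig_lam.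
have m_gt0 : (0 < m)%N := leq_trans p_gt0 le_pm.
have n_gt0 : (0 < n)%N := leq_trans m_gt0 le_mn.
have [Aq_sym Aq_unit Ah_inv _] := spd_invsqrt Ah_spd Aq_def.
have [Sq_sym Sq_unit Sh_inv _] := spd_invsqrt Sh_spd Sq_def.
have [Xq_sym Xq_unit Xh_inv _] := spd_invsqrt Xh_spd Xq_def.
have [A_sym _] := A_spd; have [E_sym _] := E_spsd.
have [l -> [x [y [z [nz row1 row2 row3]]]]] :=
  scaled_system A_sym E_sym Ah_spd Sh_spd Xh_spd Aq_def Sq_def Xq_def eig_lam.
exists l => // _; rewrite -/K in row2 row3.
set Rm := Sq *m B *m Aq in row1 row2.
have Rm_inj (v : 'cV[R]_m) : Rm^T *m v = 0 -> v = 0 by exact: row_free_sandwich_tr_inj.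
have K_inj (v : 'cV[R]_p) : K^T *m v = 0 -> v = 0 by exact: row_free_sandwich_tr_inj.
have RtE : Sq *m St *m Sq = Rm *m Rm^T.
  by rewrite /St /Stilde Ah_inv /Rm !trmx_mul Sq_sym Aq_sym !mulmxA.
(* Matrix form of the relation between the indicators X, K and E at a common vector. *)
have XtE : Xq *m Xt *m Xq = Xq *m E *m Xq + K *m K^T.
  rewrite /Xt /Xtilde Sh_inv mulmxDr mulmxDl; congr (_ + _).
  by rewrite /K !trmx_mul Sq_sym Xq_sym !mulmxA.
have At_spd : spd_mx (Aq *m A *m Aq) by exact: spd_sandwich.
have Rt_spd : spd_mx (Sq *m St *m Sq) by rewrite RtE; exact: spd_gram.
have Kt_spd : spd_mx (K *m K^T) by exact: spd_gram.
have Et_spsd : spsd_mx (Xq *m E *m Xq) by exact: spsd_sandwich.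
have Xt_spd : spd_mx (Xq *m Xt *m Xq).
  have [Et_sym _] := Et_spsd; have [Kt_sym Kt_gt0] := Kt_spd.
  rewrite XtE; split=> [|v v0]; first by rewrite linearD /= Et_sym Kt_sym.
  rewrite mulmxDr mulmxDl mxE ltr_wpDl ?Kt_gt0 //.
  by have [_ ->] := Et_spsd.
have eigA a : eigenvalue (invmx Ah *m A) a = eigenvalue (Aq *m A *m Aq) a.
  by rewrite Ah_inv eigenvalue_sandwich.
have eigR a : eigenvalue (invmx Sh *m St) a = eigenvalue (Sq *m St *m Sq) a.
  by rewrite Sh_inv eigenvalue_sandwich.
have eigX a : eigenvalue (invmx Xh *m Xt) a = eigenvalue (Xq *m Xt *m Xq) a.
  by rewrite Xh_inv eigenvalue_sandwich.
have eigE a : eigenvalue (invmx Xh *m E) a = eigenvalue (Xq *m E *m Xq) a.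
  by rewrite Xh_inv eigenvalue_sandwich.
have eigK a : eigenvalue (K *m K^T) a = eigenvalue (K *m K^T) a by [].
have At_bnd := dot_sym_bounds (proj1 At_spd) eigA.
have Rm_bnd v : minR * dot v v <= dot (Rm^T *m v) (Rm^T *m v) <= maxR * dot v v.
  by rewrite -dot_gram -RtE; exact: (dot_sym_bounds (proj1 Rt_spd) eigR).
have K_bnd v : dot (K^T *m v) (K^T *m v) <= maxK * dot v v.
  by rewrite -dot_gram; case/andP: (dot_sym_bounds (proj1 Kt_spd) eigK v).
have E_bnd v : 0 <= dot v (Xq *m E *m Xq *m v) <= maxE * dot v v.
  rewrite (spsd_dot v Et_spsd).
  by case/andP: (dot_sym_bounds (proj1 Et_spsd) eigE v).
have X_bnd v : minX * dot v v
    <= dot v (Xq *m E *m Xq *m v) + dot (K^T *m v) (K^T *m v).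
  rewrite -dot_gram -dotDr -mulmxDl -XtE.
  by case/andP: (dot_sym_bounds (proj1 Xt_spd) eigX v).
have minA_gt0 : 0 < minA := eig_min_gt0 (proj1 At_spd) eigA n_gt0 At_spd.
have minR_gt0 : 0 < minR := eig_min_gt0 (proj1 Rt_spd) eigR m_gt0 Rt_spd.
have minX_gt0 : 0 < minX := eig_min_gt0 (proj1 Xt_spd) eigX p_gt0 Xt_spd.
have maxR_gt0 : 0 < maxR := eig_max_gt0 (proj1 Rt_spd) eigR m_gt0 Rt_spd.
have maxK_gt0 : 0 < maxK := eig_max_gt0 (proj1 Kt_spd) eigK p_gt0 Kt_spd.
have maxE_ge0 : 0 <= maxE := eig_max_ge0 (proj1 Et_spsd) eigE p_gt0 Et_spsd.
(* By contraposition: for [l] outside both intervals, each of the regions left of [mu_a], in the gap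
   with [l <= 0], in the gap with [l > 0], and right of [muu] forces [x], [y] and [z] to vanish. *)
rewrite !in_itv /=; apply/negPn/negP => out; apply: nz; move: out.
rewrite negb_or !negb_and -!ltNge => /andP[out1 out2].
case/orP: out2 => [l_lt_mul|l_gt_muu].
  case/orP: out1 => [l_lt|l_gt].
    exact: (ker_lt_mu_a At_bnd Rm_bnd K_bnd E_bnd minA_gt0 minA_lt1 maxR_gt0
      maxK_gt0 row1 row2 row3).
  have [l_le0|l_gt0] := leP l 0.
    exact: (ker_gap_le0 (proj1 At_spd) At_bnd Rm_bnd E_bnd K_inj minA_gt0 maxA_gt1
      maxA_lt2 minR_gt0 row1 row2 row3).
  move: l_lt_mul; rewrite lt_min => /andP[l_lt_X l_lt_mu].
  exact: (ker_gap_gt0 (proj1 At_spd) At_bnd Rm_bnd E_bnd X_bnd minA_gt0 minA_lt1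
    maxR_gt0 minX_gt0 row1 row2 row3).
move: l_gt_muu; rewrite !gt_max => /and3P[l_gt1 l_gt2 l_gt3].
exact: (ker_gt_muu At_bnd Rm_bnd K_bnd E_bnd maxA_gt1 minR_gt0 maxR_gt0 maxK_gt0
  maxE_ge0 row1 row2 row3).
Qed.
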